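(* For $\mathsf x\in\mathfrak{gl}_n(\mathbb C)$, the variety $\mathcal B(\mathsf x,H(\mathbf m_{\mathbf{max}}))$ is reducible if and only if there is some $\lambda\in\mathbb C$ such that $\mathsf x-\lambda I_n$ has rank one.
   Context: Let $n$ be a positive integer, $G=GL_n(\mathbb C)$, and $B\subseteq G$ the subgroup of upper triangular matrices. Let $\mathbf m_{\mathbf{max}}=(n-1,n,\dots,n)$ (length $n$), and let $H(\mathbf m_{\mathbf{max}})$ be the space of matrices $\mathsf a=(\mathsf a_{ij})\in\mathfrak{gl}_n(\mathbb C)$ with $\mathsf a_{ij}=0$ whenever $i>\mathbf m_{\mathbf{max}}(j)$, i.e. with $\mathsf a_{n1}=0$. Then $\mathcal B(\mathsf x,H(\mathbf m_{\mathbf{max}}))=\{gB\in G/B\mid g^{-1}\mathsf xg\in H(\mathbf m_{\mathbf{max}})\}$, a Zariski closed subset of the flag variety $G/B$; equivalently, it is the set of full flags $V_\bullet$ in $\mathbb C^n$ with $\mathsf xV_1\subseteq V_{n-1}$. A variety is reducible if it is a union of two proper closed subsets. $I_n$ is the identity matrix.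
   Formalization: The theorem assumes n ≥ 3: for n = 1 the variety is a point or empty although x − λI has rank one for every λ ≠ x, and for n = 2 the matrix x = E_12 has rank one while its variety is a single flag, so the claim for all x fails. *)

(* Defs.v *)
From HB Require Import structures.
From mathcomp Require Import -(notations) mpoly.
From mathcomp Require Import all_boot all_order all_algebra.
From mathcomp Require Import all_classical all_reals topology.
From mathcomp Require Export complex.

Set Implicit Arguments.
Unset Strict Implicit.
Unset Printing Implicit Defensive.

Import GRing.Theory.
Local Open Scope classical_set_scope.
Local Open Scope quotient_scope.
Local Open Scope ring_scope.

Record GL (F : fieldType) (n : nat) : Type := MkGL {
  gl_mx :> 'M[F]_n;
  gl_unit : gl_mx \in unitmx }.

HB.instance Definition _ (F : fieldType) (n : nat) :=
  [isSub for @gl_mx F n].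
HB.instance Definition _ (F : fieldType) (n : nat) :=
  [Choice of GL F n by <:].

(* The n * n indeterminates stand for the matrix entries, in row-major order. *)
Definition entry_eval (F : fieldType) (n : nat)
    (p : mpoly (n * n) F) (A : 'M[F]_n) : F :=
  meval (fun k => mxvec A 0 k) p.

Definition zero_locus (F : fieldType) (n : nat)
    (S : set (mpoly (n * n) F)) : set (GL F n) :=
  [set g | forall p, S p -> entry_eval p g = 0].

Definition zariski_open (F : fieldType) (n : nat) (U : set (GL F n)) : Prop :=
  exists S, U = ~` zero_locus S.

Section ZariskiTopology.
Variables (F : fieldType) (n : nat).

Lemma zariski_openT : zariski_open [set: GL F n].
Proof.
exists [set (1 : mpoly (n * n) F)]; apply/seteqP; split=> // g _ /(_ 1 erefl).
by rewrite /entry_eval meval1 => /eqP; rewrite oner_eq0.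
Qed.

Lemma zariski_openI : setI_closed (@zariski_open F n).
Proof.
move=> _ _ [S ->] [S' ->].
exists [set p | exists q r, [/\ S q, S' r & p = q * r]].
rewrite -setCU; congr (~` _); apply/seteqP; split=> g.
  move=> [Sg | Sg] _ [q [r [Sq Sr ->]]]; rewrite /entry_eval mevalM.
    by rewrite [X in X * _](Sg q Sq) mul0r.
  by rewrite [X in _ * X](Sg r Sr) mulr0.
move=> gSS'; have [Sg|nSg] := pselect (zero_locus S g); [by left | right].
move=> r Sr; apply/eqP/negPn/negP=> rn0; apply: nSg => q Sq; apply/eqP.
have := gSS' (q * r) (ex_intro _ q (ex_intro _ r (And3 Sq Sr erefl))).
rewrite /entry_eval mevalM => /eqP.
by rewrite mulf_eq0 => /orP[//|r0]; rewrite /entry_eval r0 in rn0.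
Qed.

Lemma zariski_open_bigU (I : Type) (f : I -> set (GL F n)) :
  (forall i, zariski_open (f i)) -> zariski_open (\bigcup_i f i).
Proof.
move=> /choice[S fE]; exists (\bigcup_i S i).
rewrite -[LHS]setCK setC_bigcup; congr (~` _); apply/seteqP; split=> g.
  by move=> gS p [i _ Sp]; have := gS i Logic.I; rewrite fE setCK; exact.
by move=> gS i _; rewrite fE setCK => p Sp; apply: gS; exists i.
Qed.

HB.instance Definition _ := isOpenTopological.Build (GL F n)
  zariski_openT zariski_openI zariski_open_bigU.

End ZariskiTopology.

Definition borel (F : fieldType) (n : nat) (b : 'M[F]_n) : bool :=
  (b \in unitmx) && is_trig_mx b^T.

Definition same_coset (F : fieldType) (n : nat) (g h : GL F n) : bool :=
  borel (invmx g *m h).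

Section Cosets.
Variables (F : fieldType) (n : nat).

Lemma trigmxM (A B : 'M[F]_n) :
  is_trig_mx A -> is_trig_mx B -> is_trig_mx (A *m B).
Proof.
move=> /is_trig_mxP tA /is_trig_mxP tB; apply/is_trig_mxP => i j ltij.
rewrite mxE big1 // => k _; case: (ltnP i k) => [ltik|leki].
  by rewrite tA // mul0r.
by rewrite (tB k j) ?mulr0 // (leq_ltn_trans leki).
Qed.

Lemma trigmxV (A : 'M[F]_n) :
  A \in unitmx -> is_trig_mx A -> is_trig_mx (invmx A).
Proof.
move=> uA tA; have /is_trig_mxP tA' := tA; apply/is_trig_mxP => i j.
have [m lem] := ubnP (val i); elim: m i lem => // m IH i lem ltij.
have Aii : A i i != 0.
  move: uA; rewrite unitmxE det_trig // unitfE => /prodf_neq0; exact.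
have /matrixP/(_ i j) := mulmxV uA.
rewrite !mxE (bigD1 i) //= big1 ?addr0 => [|k neki].
  have -> : (i == j) = false by apply/negbTE; rewrite -val_eqE /= ltn_eqF.
  by move=> /eqP; rewrite mulf_eq0 (negbTE Aii) => /eqP.
case: (ltngtP i k) => [ltik|ltki|/val_inj eqik].
- by rewrite tA' // mul0r.
- have Bkj : invmx A k j = 0 by apply: (IH k (leq_trans ltki lem));
    exact: ltn_trans ltij.
  by rewrite Bkj mulr0.
- by rewrite eqik eqxx in neki.
Qed.

Lemma same_coset_refl : reflexive (@same_coset F n).
Proof.
move=> g; rewrite /same_coset /borel mulVmx ?gl_unit // unitmx1 trmx1 /=.
exact: scalar_mx_is_trig.
Qed.

Lemma same_coset_symmetric : symmetric (@same_coset F n).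
Proof.
suff S (g h : GL F n) : same_coset g h -> same_coset h g.
  by move=> g h; apply/idP/idP; apply: S.
case/andP => u t; apply/andP; split;
  first by rewrite unitmx_mul unitmx_inv !gl_unit.
have -> : invmx h *m g = invmx (invmx g *m h).
  apply: (can_inj (mulKmx u)); rewrite mulmxV //.
  by rewrite -mulmxA (mulmxA h) mulmxV ?gl_unit // mul1mx mulVmx ?gl_unit.
by rewrite trmx_inv; apply: trigmxV; rewrite ?unitmx_tr.
Qed.

Lemma same_coset_trans : transitive (@same_coset F n).
Proof.
move=> h g k /andP[_ t1] /andP[_ t2]; apply/andP; split.
  by rewrite unitmx_mul unitmx_inv !gl_unit.
have -> : invmx g *m k = (invmx g *m h) *m (invmx h *m k).
  by rewrite -mulmxA (mulmxA h) mulmxV ?gl_unit // mul1mx.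
by rewrite trmx_mul; apply: trigmxM.
Qed.

Definition coset_equiv : equiv_rel (GL F n) :=
  EquivRel (@same_coset F n)
    same_coset_refl same_coset_symmetric same_coset_trans.

End Cosets.

(* G/B with the quotient of the Zariski topology of G: this is the underlying
   space of the quotient variety, i.e. its Zariski topology. *)
Definition flag_variety (F : fieldType) (n : nat) : topologicalType :=
  quotient_topology {eq_quot (coset_equiv F n)}.

Definition coset (F : fieldType) (n : nat) (g : GL F n) : flag_variety F n :=
  \pi_({eq_quot (coset_equiv F n)}) g.

(* Ordinals start at 0, while the values of m refer to rows numbered from 1. *)
Definition hessenberg_space (F : fieldType) (n : nat) (m : 'I_n -> nat) :
    set 'M[F]_n :=
  [set a | forall i j : 'I_n, (m j < i.+1)%N -> a i j = 0].

Definition m_max (n : nat) (j : 'I_n) : nat :=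
  if val j == 0%N then n.-1 else n.
Arguments m_max : clear implicits.

Definition hessenberg_variety (F : fieldType) (n : nat)
    (x : 'M[F]_n) (H : set 'M[F]_n) : set (flag_variety F n) :=
  [set coset g | g in [set g : GL F n | H (invmx g *m x *m g)]].

(* X is given the subspace topology, so its closed subsets are the X `&` Z
   with Z closed in the ambient space. *)
Definition reducible (T : topologicalType) (X : set T) : Prop :=
  exists Z1 Z2 : set T,
    [/\ closed Z1, closed Z2, X `&` Z1 `<` X, X `&` Z2 `<` X
      & X = (X `&` Z1) `|` (X `&` Z2)].

(* Main.v *)
Require Import Defs.
From mathcomp Require Import -(notations) mpoly.
From mathcomp Require Import all_boot all_order all_algebra.
From mathcomp Require Import all_classical all_reals topology.
From mathcomp Require Import perm ring.

(** A flag enters the condition only through its line and its hyperplane: for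
    g in GL_n put v = g e_1 and let f be the last row of g^-1.  Then f v = 0,
    and gB lies in the variety exactly when f x v = 0.  Closed subsets of G/B
    are the B-stable zero loci in GL_n, so reducibility is a question about the
    set Y of those g and about polynomials in the entries of g.

    If x - l = u r has rank one, then f v = 0 turns the condition into
    (f u)(r v) = 0, and the closed conditions f u = 0 and r v = 0 cover Y.
    Neither holds on all of Y, because n >= 3 leaves room for a flag with
    r v = 0 and f u <> 0, and for one with f u = 0 and r v <> 0.

    Conversely, Y is irreducible when no x - l has rank one.  If x is scalar
    then Y is GL_n.  Otherwise every x - l has rank at least two, and the
    argument uses polynomial curves t |-> (v_t, f_t) with
    f_t v_t = f_t x v_t = 0.  Such a curve lifts to a curve of matrices with
    prescribed ends ([lift_curve]); where it is invertible it lies in Y up to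
    finitely many t, and a product of polynomials not vanishing at some t does
    not vanish at infinitely many ([generic_lift]).

    - If v is not an eigenvector, the forms killing v and x v are exactly the
      contractions of 3-forms with v and x v.  Joining two vectors and two
      3-forms by segments therefore joins two such points of Y
      ([connecting_curve]).
    - A point of Y whose v is an eigenvector is the start of a curve that
      leaves the eigenvectors ([incident_curve_from_eigenpair]).  This is where
      the rank enters: if x has rank one modulo scalars, the points with v an
      eigenvector contain a whole component of Y.  For y = x - l with l
      the eigenvalue, a curve linear in t works unless y maps all vectors
      killed by f y into the line of v, in which case a quadratic curve may be
      needed.

    So two polynomials p and q, each nonzero somewhere on Y, are each nonzero
    at some point of Y with v not an eigenvector, hence simultaneously nonzero
    somewhere on a curve joining these points ([hess_points_irreducible]). *)

Set Implicit Arguments.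
Unset Strict Implicit.
Unset Printing Implicit Defensive.
Import GRing.Theory Num.Theory.
Local Open Scope ring_scope.

(** * Linear forms and pairs of vectors *)

Section Pairing.
Variables (F : fieldType) (n : nat).
Implicit Types (f g : 'rV[F]_n) (u v w : 'cV[F]_n) (i j : 'I_n)
  (c : F) (y : 'M[F]_n).

Definition pairing f v : F := (f *m v) 0 0.

Lemma pairingDl f f' v : pairing (f + f') v = pairing f v + pairing f' v.
Proof. by rewrite /pairing mulmxDl mxE. Qed.

Lemma pairingZl c f v : pairing (c *: f) v = c * pairing f v.
Proof. by rewrite /pairing -scalemxAl mxE. Qed.

Lemma pairingDr f v v' : pairing f (v + v') = pairing f v + pairing f v'.
Proof. by rewrite /pairing mulmxDr mxE. Qed.

Lemma pairingZr c f v : pairing f (c *: v) = c * pairing f v.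
Proof. by rewrite /pairing -scalemxAr mxE. Qed.

Lemma pairing0l v : pairing 0 v = 0.
Proof. by rewrite /pairing mul0mx mxE. Qed.

Lemma pairing0r f : pairing f 0 = 0.
Proof. by rewrite /pairing mulmx0 mxE. Qed.

Lemma pairingA f y v : pairing (f *m y) v = pairing f (y *m v).
Proof. by rewrite /pairing mulmxA. Qed.

Lemma mulmx_pairing f v : f *m v = (pairing f v)%:M.
Proof. exact: mx11_scalar. Qed.

Lemma pairing_delta_l i v : pairing (delta_mx 0 i) v = v i 0.
Proof. by rewrite /pairing -rowE mxE. Qed.

Lemma pairing_delta_r f i : pairing f (delta_mx i 0) = f 0 i.
Proof. by rewrite /pairing -colE mxE. Qed.

Lemma pairing_col m f (A : 'M[F]_(n, m)) (j : 'I_m) :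
  pairing f (col j A) = (f *m A) 0 j.
Proof. by rewrite colE /pairing mulmxA -colE mxE. Qed.

Definition pairingE :=
  (pairingDl, pairingZl, pairingDr, pairingZr, pairing0l, pairing0r).

Lemma form_dual f : f != 0 -> exists w, pairing f w = 1.
Proof.
case/rV0Pn => i fi0; exists ((f 0 i)^-1 *: delta_mx i 0).
by rewrite pairingZr pairing_delta_r mulVf.
Qed.

Lemma vec_dual v : v != 0 -> exists f, pairing f v = 1.
Proof.
case/cV0Pn => i vi0; exists ((v i 0)^-1 *: delta_mx 0 i).
by rewrite pairingZl pairing_delta_l mulVf.
Qed.

Lemma mx_eq_cols (A A' : 'M[F]_n) :
  (forall v : 'cV_n, A *m v = A' *m v) -> A = A'.
Proof.
move=> eqA; apply/matrixP => i j.
by have /colP/(_ i) := eqA (delta_mx j 0); rewrite -!colE !mxE.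
Qed.

(** Independence of two vectors is expressed by minors because a minor is
    polynomial along a polynomial curve, so that independence at one point
    gives independence at almost all points. *)
Definition minor2 v u i j : F := v i 0 * u j 0 - v j 0 * u i 0.

Definition independent v u : Prop := exists i j, minor2 v u i j != 0.

(** Cramer's rule for a nonzero minor: the dual basis of the plane spanned by
    the two vectors, extended by coordinate forms. *)
Lemma independent_dual v u : independent v u ->
  exists f g, [/\ pairing f v = 1, pairing f u = 0,
                  pairing g v = 0 & pairing g u = 1].
Proof.
case=> i [j]; set d := minor2 v u i j => d0.
exists (d^-1 *: (u j 0 *: delta_mx 0 i + (- u i 0) *: delta_mx 0 j)).
exists (d^-1 *: ((- v j 0) *: delta_mx 0 i + v i 0 *: delta_mx 0 j)).
have dE : d = v i 0 * u j 0 - v j 0 * u i 0 by [].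
rewrite !pairingE !pairing_delta_l; split.
- by rewrite -[RHS](mulVf d0) dE; ring.
- by ring.
- by ring.
- by rewrite -[RHS](mulVf d0) dE; ring.
Qed.

Lemma dependentP v u : v != 0 -> ~ independent v u -> exists c, u = c *: v.
Proof.
case/cV0Pn => i vi0 dep; exists (u i 0 / v i 0); apply/colP => j.
have /eqP : minor2 v u i j = 0.
  by apply/eqP/negPn/negP => m0; apply: dep; exists i, j.
rewrite /minor2 subr_eq0 => /eqP e; rewrite mxE.
by apply: (mulfI vi0); rewrite e; field.
Qed.

End Pairing.

(** * Polynomial functions and curves *)

Section PolynomialFunctions.
Variable F : numFieldType.
Implicit Types (f g : F -> F).

Definition polyfun f := exists P : {poly F}, forall t, f t = P.[t].

Lemma polyfun_ext f g : f =1 g -> polyfun f -> polyfun g.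
Proof. by move=> fg [P fP]; exists P => t; rewrite -fg. Qed.

Lemma polyfun_cst c : polyfun (fun=> c).
Proof. by exists c%:P => t; rewrite hornerC. Qed.

Lemma polyfun_id : polyfun id.
Proof. by exists 'X => t; rewrite hornerX. Qed.

Lemma polyfunD f g : polyfun f -> polyfun g -> polyfun (fun t => f t + g t).
Proof. by case=> P fP [Q gQ]; exists (P + Q) => t; rewrite hornerD fP gQ. Qed.

Lemma polyfunM f g : polyfun f -> polyfun g -> polyfun (fun t => f t * g t).
Proof. by case=> P fP [Q gQ]; exists (P * Q) => t; rewrite hornerM fP gQ. Qed.

Lemma polyfunN f : polyfun f -> polyfun (fun t => - f t).
Proof. by case=> P fP; exists (- P) => t; rewrite hornerN fP. Qed.

Lemma polyfunX f k : polyfun f -> polyfun (fun t => f t ^+ k).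
Proof. by case=> P fP; exists (P ^+ k) => t; rewrite horner_exp fP. Qed.

Lemma polyfun_sum (I : Type) (r : seq I) (h : I -> F -> F) :
  (forall i, polyfun (h i)) -> polyfun (fun t => \sum_(i <- r) h i t).
Proof.
move=> H; elim: r => [|i r IH].
  by apply: polyfun_ext (polyfun_cst 0) => t; rewrite big_nil.
by apply: polyfun_ext (polyfunD (H i) IH) => t; rewrite big_cons.
Qed.

Lemma polyfun_prod (I : Type) (r : seq I) (h : I -> F -> F) :
  (forall i, polyfun (h i)) -> polyfun (fun t => \prod_(i <- r) h i t).
Proof.
move=> H; elim: r => [|i r IH].
  by apply: polyfun_ext (polyfun_cst 1) => t; rewrite big_nil.
by apply: polyfun_ext (polyfunM (H i) IH) => t; rewrite big_cons.
Qed.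

(** The affine line is irreducible; this is what makes curves detect
    irreducibility.  The product has more candidate roots among the integers
    than its degree permits. *)
Lemma nonzero_polyfunM f g a b : polyfun f -> polyfun g ->
  f a != 0 -> g b != 0 -> exists t, f t * g t != 0.
Proof.
case=> P fP [Q gQ] fa gb.
have P0 : P != 0 by apply: contraNneq fa => P0; rewrite fP P0 horner0.
have Q0 : Q != 0 by apply: contraNneq gb => Q0; rewrite gQ Q0 horner0.
have [//|none] := pselect (exists t, f t * g t != 0).
have PQ0 : P * Q != 0 by rewrite mulf_neq0.
suff : (size [seq k%:R : F | k <- iota 0 (size (P * Q)%R)] < size (P * Q)%R)%N.
  by rewrite size_map size_iota ltnn.
apply: (max_poly_roots PQ0).
  apply/allP => t _; apply/negPn/negP => nr; apply: none; exists t.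
  by rewrite fP gQ -hornerM.
by rewrite map_inj_uniq ?iota_uniq // => k l /eqP; rewrite eqr_nat => /eqP.
Qed.

Definition polycurve m n (A : F -> 'M[F]_(m, n)) :=
  forall i j, polyfun (fun t => A t i j).

Lemma polycurve_cst m n (A : 'M[F]_(m, n)) : polycurve (fun=> A).
Proof. by move=> i j; exact: polyfun_cst. Qed.

Lemma polycurveD m n (A B : F -> 'M[F]_(m, n)) :
  polycurve A -> polycurve B -> polycurve (fun t => A t + B t).
Proof.
move=> pA pB i j; apply: polyfun_ext (polyfunD (pA i j) (pB i j)) => t.
by rewrite mxE.
Qed.

Lemma polycurveZ m n c (A : F -> 'M[F]_(m, n)) :
  polyfun c -> polycurve A -> polycurve (fun t => c t *: A t).
Proof.
move=> pc pA i j; apply: polyfun_ext (polyfunM pc (pA i j)) => t.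
by rewrite mxE.
Qed.

Lemma polycurve_line m n (A B : 'M[F]_(m, n)) : polycurve (fun t => A + t *: B).
Proof.
apply: polycurveD; first exact: polycurve_cst.
by apply: polycurveZ; [exact: polyfun_id | exact: polycurve_cst].
Qed.

Lemma polycurveM m n p (A : F -> 'M[F]_(m, n)) (B : F -> 'M[F]_(n, p)) :
  polycurve A -> polycurve B -> polycurve (fun t => A t *m B t).
Proof.
move=> pA pB i j.
have H k : polyfun (fun t => A t i k * B t k j) by exact: polyfunM.
by apply: polyfun_ext (polyfun_sum _ H) => t; rewrite mxE.
Qed.

Lemma polyfun_pairing n (f : F -> 'rV[F]_n) v :
  polycurve f -> polycurve v -> polyfun (fun t => pairing (f t) (v t)).
Proof. by move=> pf pv; exact: (polycurveM pf pv). Qed.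

Lemma polyfun_det n (A : F -> 'M[F]_n) :
  polycurve A -> polyfun (fun t => \det (A t)).
Proof.
move=> pA; apply: polyfun_sum => s; apply: polyfunM; first exact: polyfun_cst.
by apply: polyfun_prod => i; exact: pA.
Qed.

(** Regular functions on GL_n restrict to polynomials along a curve. *)
Lemma polyfun_entry_eval n (p : mpoly (n * n) F) (A : F -> 'M[F]_n) :
  polycurve A -> polyfun (fun t => entry_eval p (A t)).
Proof.
move=> pA.
have H m : polyfun (fun t => mcoeff m p *
    \prod_k mxvec (A t) 0 k ^+ fun_of_multinom m k).
  apply: polyfunM; first exact: polyfun_cst.
  apply: polyfun_prod => k; apply: polyfunX.
  case/mxvec_indexP: k => i j.
  by apply: polyfun_ext (pA i j) => t; rewrite mxvecE.
by apply: polyfun_ext (polyfun_sum _ H) => t; rewrite /entry_eval mevalE.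
Qed.

Lemma polyfun_minor2 n (v u : F -> 'cV[F]_n) i j :
  polycurve v -> polycurve u -> polyfun (fun t => minor2 (v t) (u t) i j).
Proof.
by move=> pv pu; apply: polyfunD; [|apply: polyfunN]; apply: polyfunM.
Qed.

End PolynomialFunctions.

(** * Curves of incident vectors and forms *)

Section Incidence.
Variables (F : numFieldType) (n : nat).
Implicit Types (f g : 'rV[F]_n) (u v w : 'cV[F]_n) (x y : 'M[F]_n).

Definition incident_curve x (v : F -> 'cV[F]_n) (f : F -> 'rV[F]_n) : Prop :=
  [/\ polycurve v, polycurve f, forall t, pairing (f t) (v t) = 0
    & forall t, pairing (f t) (x *m v t) = 0].

(** The contraction of the 3-form f /\ g /\ h with v and u, as a linear form in
    the remaining argument. *)
Definition wedge_contract f g h v u : 'rV[F]_n :=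
  (pairing f v * pairing g u - pairing f u * pairing g v) *: h
  + (pairing g v * pairing h u - pairing g u * pairing h v) *: f
  + (pairing h v * pairing f u - pairing h u * pairing f v) *: g.

Lemma wedge_contract_kills_l f g h v u :
  pairing (wedge_contract f g h v u) v = 0.
Proof. by rewrite /wedge_contract !pairingE; ring. Qed.

Lemma wedge_contract_kills_r f g h v u :
  pairing (wedge_contract f g h v u) u = 0.
Proof. by rewrite /wedge_contract !pairingE; ring. Qed.

(** Wedging h with the dual basis of the plane of v and u makes the contraction
    return h.  Hence the forms killing v and u are parametrized by 3-forms,
    uniformly in v and u. *)
Lemma wedge_contract_surj h v u : independent v u ->
  pairing h v = 0 -> pairing h u = 0 ->
  exists f g, wedge_contract f g h v u = h.
Proof.
case/independent_dual => f [g [fv fu gv gu]] hv hu; exists f, g.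
rewrite /wedge_contract fv fu gv gu hv hu !(mul0r, mulr0, mul1r, subrr, subr0).
by rewrite scale1r !scale0r !addr0.
Qed.

Lemma polycurve_wedge_contract f g h (v u : F -> 'cV[F]_n) :
  polycurve v -> polycurve u ->
  polycurve (fun t => wedge_contract f g h (v t) (u t)).
Proof.
move=> pv pu.
have pp (k l : 'rV[F]_n) :
    polyfun (fun t => pairing k (v t) * pairing l (u t)
                      - pairing k (u t) * pairing l (v t)).
  by apply: polyfunD; [|apply: polyfunN];
    apply: polyfunM; apply: polyfun_pairing => //; exact: polycurve_cst.
by do 2?apply: polycurveD; apply: polycurveZ => //; exact: polycurve_cst.
Qed.

Definition segment m k (A B : 'M[F]_(m, k)) (t : F) := (1 - t) *: A + t *: B.

Lemma segment0 m k (A B : 'M[F]_(m, k)) : segment A B 0 = A.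
Proof. by rewrite /segment subr0 scale1r scale0r addr0. Qed.

Lemma segment1 m k (A B : 'M[F]_(m, k)) : segment A B 1 = B.
Proof. by rewrite /segment subrr scale0r add0r scale1r. Qed.

Lemma polycurve_segment m k (A B : F -> 'M[F]_(m, k)) :
  polycurve A -> polycurve B -> polycurve (fun t => segment (A t) (B t) t).
Proof.
move=> pA pB; apply: polycurveD; apply: polycurveZ => //;
  last exact: polyfun_id.
by apply: polyfunD; [exact: polyfun_cst | apply: polyfunN; exact: polyfun_id].
Qed.

(** The vectors v and v' are joined by a segment, and so are the two 3-forms
    that contract to f and f'; contracting along the way keeps both incidence
    conditions, whatever happens to the independence of v_t and x v_t. *)
Lemma connecting_curve x v f v' f' :
  independent v (x *m v) -> independent v' (x *m v') ->
  pairing f v = 0 -> pairing f (x *m v) = 0 ->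
  pairing f' v' = 0 -> pairing f' (x *m v') = 0 ->
  exists vt ft, [/\ incident_curve x vt ft,
    vt 0 = v, ft 0 = f, vt 1 = v' & ft 1 = f'].
Proof.
move=> iv iv' fv fxv fv' fxv'.
have [a [b abf]] := wedge_contract_surj iv fv fxv.
have [a' [b' abf']] := wedge_contract_surj iv' fv' fxv'.
pose vt := segment v v'; pose u t := x *m vt t.
have pv : polycurve vt.
  by apply: polycurve_segment; exact: polycurve_cst.
have pu : polycurve u by apply: polycurveM => //; exact: polycurve_cst.
pose ft t := segment (wedge_contract a b f (vt t) (u t))
                     (wedge_contract a' b' f' (vt t) (u t)) t.
exists vt, ft; split.
- split=> //.
  + by apply: polycurve_segment; exact: polycurve_wedge_contract.
  + move=> t; rewrite /ft /segment pairingDl !pairingZl.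
    by rewrite !wedge_contract_kills_l !mulr0 addr0.
  + move=> t; rewrite /ft /segment pairingDl !pairingZl.
    by rewrite !wedge_contract_kills_r !mulr0 addr0.
- exact: segment0.
- by rewrite /ft /u segment0 /vt segment0.
- exact: segment1.
- by rewrite /ft /u segment1 /vt segment1.
Qed.

Definition not_rank_le1 y : Prop :=
  forall (u : 'cV[F]_n) (f : 'rV[F]_n), y <> u *m f.

(** Ansatz v + t w, f + t psi.  The conditions in degree one and two in t are
    psi v = - f w, f y w = 0, psi w = 0 and psi y w = 0; they can be solved for
    psi because v and y w are independent.  The curve leaves the eigenvectors
    since y (v + t w) = t y w. *)
Lemma incident_curve_from_eigenpair_indep y v f w :
  v != 0 -> y *m v = 0 -> pairing f v = 0 ->
  pairing f (y *m w) = 0 -> independent v (y *m w) ->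
  exists vt ft, [/\ incident_curve y vt ft, vt 0 = v, ft 0 = f
    & exists t, independent (vt t) (y *m vt t)].
Proof.
move=> v0 yv fv fyw ivw.
pose vt t := v + t *: w.
have yvt t : y *m vt t = t *: (y *m w).
  by rewrite mulmxDr yv add0r -scalemxAr.
have pv : polycurve vt by exact: polycurve_line.
have indep_vt : exists t, independent (vt t) (y *m vt t).
  case: ivw => i [j m0].
  have pm : polyfun (fun t => minor2 (vt t) (y *m w) i j).
    by apply: polyfun_minor2 => //; exact: polycurve_cst.
  have m00 : minor2 (vt 0) (y *m w) i j != 0 by rewrite /vt scale0r addr0.
  have [t tm] := nonzero_polyfunM (polyfun_id F) pm (oner_neq0 F) m00.
  exists t, i, j; rewrite yvt; apply: contraNneq tm => <-.
  by rewrite /minor2 !mxE; apply/eqP; ring.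
suff [psi [psiv psiw psiyw]] : exists psi,
    [/\ pairing psi v = - pairing f w, pairing psi w = 0
      & pairing psi (y *m w) = 0].
  exists vt, (fun t => f + t *: psi); split=> //.
  - split=> //.
    + exact: polycurve_line.
    + by move=> t; rewrite /vt !pairingE fv psiv psiw; ring.
    + by move=> t; rewrite yvt !pairingE fyw psiyw; ring.
  - by rewrite /vt scale0r addr0.
  - by rewrite scale0r addr0.
have [fw|fw] := eqVneq (pairing f w) 0.
  by exists 0; rewrite !pairing0l fw oppr0.
have [th [_ [thv thyw _ _]]] := independent_dual ivw.
(* f kills both v and y w, so adding a multiple of it only corrects psi w. *)
exists (- pairing f w *: (th + (- pairing th w / pairing f w) *: f)).
rewrite !pairingE thv thyw fv fyw; split; [by ring | | by ring].
by field.
Qed.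

(** If f w = 0, the line v + t w with f constant works.  Otherwise a curve
    linear in t need not exist, and the ansatz is v + t w + t^2 z', f + t psi
    with k = - f w.  Comparing coefficients of t gives psi v = k,
    f z' = - psi w, f y z' = - k, psi z' = 0 and psi y z' = 0.  Here
    z' = z0 + d w + c v for a rescaling z0 of z; d solves the second equation,
    c the fourth, and the last then becomes psi (y z0 + w) = - f z0.  It is
    compatible with psi v = k because f kills v but
    f (y z0 + w) = - 2 k is not zero. *)
Lemma incident_curve_from_eigenpair_chain y v f w z :
  v != 0 -> y *m v = 0 -> pairing f v = 0 -> y *m w = v ->
  pairing f (y *m z) != 0 ->
  exists vt ft, [/\ incident_curve y vt ft, vt 0 = v, ft 0 = f
    & exists t, independent (vt t) (y *m vt t)].
Proof.
move=> v0 yv fv yw fyz.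
have fyw : pairing f (y *m w) = 0 by rewrite yw.
have [fw|fw] := eqVneq (pairing f w) 0.
  exists (fun t => v + t *: w), (fun=> f).
  have yvt t : y *m (v + t *: w) = t *: v.
    by rewrite mulmxDr yv add0r -scalemxAr yw.
  split; rewrite ?scale0r ?addr0 //.
    split; [|exact: polycurve_cst| |].
    - exact: polycurve_line.
    - by move=> t; rewrite !pairingE fv fw; ring.
    - by move=> t; rewrite yvt pairingZr fv mulr0.
  exists 1; rewrite yvt !scale1r.
  have [[i [j m0]]|] := pselect (independent v w).
    by exists i, j; apply: contraNneq m0; rewrite -oppr_eq0 /minor2 !mxE => <-;
      apply/eqP; ring.
  case/(dependentP v0) => c wc.
  by case/eqP: v0; rewrite -yw wc -scalemxAr yv scaler0.
pose k := - pairing f w.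
have k0 : k != 0 by rewrite oppr_eq0.
have {}fw : pairing f w = - k by rewrite opprK.
clearbody k.
pose z0 : 'cV[F]_n := (- k / pairing f (y *m z)) *: z.
have fyz0 : pairing f (y *m z0) = - k.
  by rewrite -scalemxAr pairingZr divfK.
clearbody z0.
have [th thv] := vec_dual v0.
pose e := (pairing f z0 + k * pairing th (y *m z0 + w)) / (k *+ 2).
pose psi : 'rV[F]_n := k *: th + e *: f.
have psiv : pairing psi v = k by rewrite !pairingE thv fv; ring.
have psiu : pairing psi (y *m z0) + pairing psi w = - pairing f z0.
  by rewrite !pairingDl !pairingZl fyz0 fw /e pairingDr; field.
clearbody psi.
pose d := (pairing f z0 + pairing psi w) / k.
pose c := - (pairing psi z0 + d * pairing psi w) / k.
pose z' : 'cV[F]_n := z0 + d *: w + c *: v.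
have yz' : y *m z' = y *m z0 + d *: v.
  by rewrite !mulmxDr -!scalemxAr yv yw scaler0 addr0.
have fz' : pairing f z' = - pairing psi w.
  by rewrite !pairingE fv fw /d; field.
have fyz' : pairing f (y *m z') = - k.
  by rewrite yz' !pairingE fyz0 fv mulr0 addr0.
have psiz' : pairing psi z' = 0.
  by rewrite !pairingDr !pairingZr psiv /c; field.
have psiyz' : pairing psi (y *m z') = 0.
  rewrite yz' pairingDr pairingZr psiv /d divfK //.
  by rewrite addrCA psiu subrr.
clearbody z'.
pose vt t := v + t *: w + t ^+ 2 *: z'.
have yvt t : y *m vt t = t *: v + t ^+ 2 *: (y *m z').
  by rewrite !mulmxDr yv add0r -!scalemxAr yw.
exists vt, (fun t => f + t *: psi); split.
- split.
  + apply: polycurveD; first exact: polycurve_line.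
    apply: polycurveZ; last exact: polycurve_cst.
    by apply: polyfunX; exact: polyfun_id.
  + exact: polycurve_line.
  + move=> t; rewrite pairingDl pairingZl !pairingDr !pairingZr.
    by rewrite fv fw fz' psiv psiz'; ring.
  + move=> t; rewrite yvt pairingDl pairingZl !pairingDr !pairingZr.
    by rewrite fv fyz' psiv psiyz'; ring.
- by rewrite /vt expr0n /= !scale0r !addr0.
- by rewrite scale0r addr0.
(* If v_t were always an eigenvector, the minors would vanish identically in
   t.  Their t^2 and t^3 coefficients make y z' - w and then z' + e' w
   multiples of v, contradicting f y z' = - k. *)
have [//|none] := pselect (exists t, independent (vt t) (y *m vt t)).
have m0 t i j : minor2 (vt t) (y *m vt t) i j = 0.
  apply/eqP/negPn/negP => m0; apply: none; exists t, i, j; exact: m0.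
have mE t i j : minor2 (vt t) (y *m vt t) i j =
    t ^+ 2 * minor2 v (y *m z' - w) i j
    + t ^+ 3 * (minor2 w (y *m z') i j - minor2 v z' i j)
    + t ^+ 4 * minor2 z' (y *m z') i j.
  by rewrite yvt /minor2 !mxE; ring.
have coef i j : minor2 v (y *m z' - w) i j = 0 /\
    minor2 w (y *m z') i j - minor2 v z' i j = 0.
  have := mE 1 i j; have := mE (-1) i j; have := mE 2%:R i j; rewrite !m0.
  move: (minor2 v (_ - w) i j) (minor2 w _ i j - _) (minor2 z' _ i j)
    => a b g e3 e2 e1.
  (* Three values of t separate the three coefficients. *)
  have two : 2%:R != 0 :> F by rewrite pnatr_eq0.
  have twelve : 12%:R != 0 :> F by rewrite pnatr_eq0.
  pose E t := t ^+ 2 * a + t ^+ 3 * b + t ^+ 4 * g.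
  have b0 : b = 0.
    apply: (mulfI two); transitivity (E 1 - E (-1)); first by rewrite /E; ring.
    by rewrite -[E 1]e1 -[E (-1)]e2 subrr mulr0.
  have g0 : g = 0.
    apply: (mulfI twelve).
    transitivity (E 2%:R - 4%:R * E 1 - 4%:R * b); first by rewrite /E; ring.
    by rewrite -[E 1]e1 -[E 2%:R]e3 b0 !mulr0 !subr0.
  by split=> //; move: e1; rewrite b0 g0 => ->; ring.
have [|e' yzw] := @dependentP _ _ v (y *m z' - w) v0.
  by case=> i [j]; rewrite (coef i j).1 eqxx.
have [|e'' zwv] := @dependentP _ _ v (z' + e' *: w) v0.
  case=> i [j] /eqP; apply; have := (coef i j).2.
  have /(congr1 (fun q => q + w)) := yzw; rewrite subrK => ->.
  by rewrite /minor2 !mxE => h; rewrite -[RHS]oppr0 -h; ring.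
have : pairing f (y *m (z' + e' *: w)) = - k.
  by rewrite mulmxDr -scalemxAr yw !pairingE fyz' fv mulr0 addr0.
rewrite zwv -scalemxAr yv scaler0 pairing0r => /esym/eqP.
by rewrite oppr_eq0 (negbTE k0).
Qed.

(** Suppose no w makes the linear ansatz solvable, that is, y maps the kernel
    of f y into the line of v.  As y is not of rank at most one, f y is not
    zero (otherwise y = v c) and y is not zero on the kernel of f y (otherwise
    y = (y z)(f y) for any z with f y z = 1); so v itself is some y w, the situation of the quadratic
    curve. *)
Lemma incident_curve_from_eigenpair y v f :
  not_rank_le1 y -> v != 0 -> y *m v = 0 -> pairing f v = 0 ->
  exists vt ft, [/\ incident_curve y vt ft, vt 0 = v, ft 0 = f
    & exists t, independent (vt t) (y *m vt t)].
Proof.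
move=> ry v0 yv fv.
have [[w [fyw ivw]]|none] := pselect (exists w, pairing f (y *m w) = 0 /\
    independent v (y *m w)).
  exact: (incident_curve_from_eigenpair_indep v0 yv fv fyw ivw).
have dep w : pairing f (y *m w) = 0 -> exists c, y *m w = c *: v.
  by move=> fyw; apply: dependentP => // ivw; apply: none; exists w.
have fy0 : f *m y != 0.
  apply/eqP => fy0.
  have /choice[c cE] : forall j, exists c, y *m delta_mx j 0 = c *: v.
    by move=> j; apply: dep; rewrite -pairingA fy0 pairing0l.
  apply: (ry v (\row_j c j)); apply/matrixP => i j.
  have /colP/(_ i) := cE j; rewrite -colE !mxE => ->.
  by rewrite big_ord1 !mxE mulrC.
have [z fyz] := form_dual fy0.
have [w [fyw yw]] : exists w, pairing f (y *m w) = 0 /\ y *m w != 0.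
  have [//|all0] := pselect (exists w, pairing f (y *m w) = 0 /\ y *m w != 0).
  exfalso; apply: (ry (y *m z) (f *m y)); apply: mx_eq_cols => w.
  rewrite -(mulmxA (y *m z)) (mulmx_pairing (f *m y)) mul_mx_scalar pairingA.
  apply/eqP; rewrite -subr_eq0 scalemxAr -mulmxBr; apply/negPn/negP => ne.
  apply: all0; exists (w - pairing f (y *m w) *: z); split=> //.
  by rewrite mulmxBr -scalemxAr -scaleNr !pairingE -(pairingA f y z) fyz; ring.
have [c ywc] := dep _ fyw.
have c0 : c != 0 by apply: contraNneq yw => c0; rewrite ywc c0 scale0r.
apply: (incident_curve_from_eigenpair_chain (w := c^-1 *: w) (z := z)) => //.
  by rewrite -scalemxAr ywc scalerA mulVf // scale1r.
by rewrite -pairingA fyz oner_neq0.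
Qed.

End Incidence.

(** * From incident pairs to flags *)

Section Lifting.
Variables (F : numFieldType) (m : nat).
Notation n := m.+2.
Implicit Types (x A : 'M[F]_n) (g h k : GL F n) (j : 'I_n).

Definition line_of (A : 'M[F]_n) : 'cV[F]_n := col ord0 A.
Definition form_of (A : 'M[F]_n) : 'rV[F]_n := row ord_max (invmx A).

Lemma form_of_mul g : form_of g *m g = delta_mx 0 ord_max.
Proof. by rewrite /form_of -row_mul mulVmx ?gl_unit // rowE mulmx1. Qed.

Lemma pairing_form_of g j : pairing (form_of g) (col j g) = (j == ord_max)%:R.
Proof. by rewrite pairing_col form_of_mul mxE. Qed.

Definition hess_point x A : Prop :=
  pairing (form_of A) (x *m line_of A) = 0.

(** A form killing all columns but the last is the last row of the inverse up
    to a scalar, which the condition ignores. *)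
Lemma hess_point_of_form x A f :
  A \in unitmx -> (forall j, j != ord_max -> pairing f (col j A) = 0) ->
  pairing f (col ord_max A) != 0 -> pairing f (x *m line_of A) = 0 ->
  hess_point x A.
Proof.
move=> uA fA; set c := pairing f _ => c0 fx.
have fE : f = c *: form_of A.
  have fAE : f *m A = c *: delta_mx 0 ord_max.
    apply/rowP => j; rewrite -pairing_col !mxE eqxx /=.
    by have [->|/fA ->] := eqVneq j ord_max; rewrite ?mulr1 ?mulr0.
  by rewrite -[f](mulmxK uA) fAE -scalemxAl -rowE.
by move/eqP: fx; rewrite fE pairingZl mulf_eq0 (negbTE c0) => /eqP.
Qed.

(** The columns of A moved along its last column into the kernel of f, with the
    denominator cleared so that the result is polynomial in f. *)
Definition project_cols A (f : 'rV[F]_n) : 'M[F]_n :=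
  pairing f (col ord_max A) *: A - col ord_max A *m (f *m A).

Lemma project_cols_kills A (f : 'rV[F]_n) j :
  pairing f (col j (project_cols A f)) = 0.
Proof.
rewrite pairing_col mulmxBr -scalemxAr [f *m (_ *m _)]mulmxA.
rewrite (mulmx_pairing f) mul_scalar_mx.
by rewrite subrr mxE.
Qed.

Lemma project_cols_id g j : j != ord_max ->
  col j (project_cols g (form_of g)) = col j g.
Proof.
move=> jm; rewrite /project_cols pairing_form_of eqxx scale1r form_of_mul.
apply/colP => i; rewrite !mxE big_ord1 !mxE eqxx (negbTE jm) mulr0 subr0 //.
Qed.

(** The first column is v_t, the middle columns lie in the kernel of f_t, and
    the last column is free; all but the first are interpolated between g
    and h. *)
Definition lift_curve (v : F -> 'cV[F]_n) (f : F -> 'rV[F]_n) g h t : 'M[F]_n :=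
  \matrix_(i, j) (if j == ord0 then v t
                  else if j == ord_max
                  then segment (col ord_max g) (col ord_max h) t
                  else segment (col j (project_cols g (f t)))
                               (col j (project_cols h (f t))) t) i 0.

Lemma col_lift_curve v f g h t j : col j (lift_curve v f g h t) =
  if j == ord0 then v t
  else if j == ord_max then segment (col ord_max g) (col ord_max h) t
  else segment (col j (project_cols g (f t))) (col j (project_cols h (f t))) t.
Proof. by apply/colP => i; rewrite !mxE. Qed.

Lemma lift_curve0 v f g h : v 0 = line_of g -> f 0 = form_of g ->
  lift_curve v f g h 0 = g.
Proof.
move=> v0 f0; apply/matrixP => i j.
have /colP/(_ i) := col_lift_curve v f g h 0 j.
rewrite [LHS]mxE => ->; rewrite !segment0 v0 f0.
have [->|_] := eqVneq j ord0; first by rewrite mxE.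
have [->|jm] := eqVneq j ord_max; first by rewrite mxE.
by rewrite project_cols_id // mxE.
Qed.

Lemma lift_curve1 v f g h : v 1 = line_of h -> f 1 = form_of h ->
  lift_curve v f g h 1 = h.
Proof.
move=> v0 f0; apply/matrixP => i j.
have /colP/(_ i) := col_lift_curve v f g h 1 j.
rewrite [LHS]mxE => ->; rewrite !segment1 v0 f0.
have [->|_] := eqVneq j ord0; first by rewrite mxE.
have [->|jm] := eqVneq j ord_max; first by rewrite mxE.
by rewrite project_cols_id // mxE.
Qed.

Lemma polycurve_project_cols A (f : F -> 'rV[F]_n) :
  polycurve f -> polycurve (fun t => project_cols A (f t)).
Proof.
move=> pf; have cst := polycurve_cst.
have pM : polycurve (fun t => col ord_max A *m (f t *m A)).
  by apply: polycurveM => //; apply: polycurveM.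
move=> i j.
apply: polyfun_ext (polyfunD (polyfunM (polyfun_pairing pf (cst _ _ _ _))
  (cst _ _ _ A i j)) (polyfunN (pM i j))) => t.
by rewrite !mxE.
Qed.

Lemma polycurve_lift_curve v f g h : polycurve v -> polycurve f ->
  polycurve (lift_curve v f g h).
Proof.
move=> pv pf i j.
suff : polyfun (fun t => col j (lift_curve v f g h t) i 0).
  by apply: polyfun_ext => t; rewrite mxE.
have [j0|j0] := eqVneq j ord0.
  by apply: polyfun_ext (pv i 0) => t; rewrite col_lift_curve j0.
have [jm|jm] := eqVneq j ord_max.
  apply: polyfun_ext (polycurve_segment (polycurve_cst (col ord_max g))
    (polycurve_cst (col ord_max h)) i 0) => t.
  by rewrite col_lift_curve (negbTE j0) jm eqxx.
have pc (A : 'M[F]_n) : polycurve (fun t => col j (project_cols A (f t))).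
  move=> a b; apply: polyfun_ext (polycurve_project_cols A pf a j) => t.
  by rewrite [RHS]mxE.
apply: polyfun_ext (polycurve_segment (pc g) (pc h) i 0) => t.
by rewrite col_lift_curve (negbTE j0) (negbTE jm).
Qed.

(** The determinant, the value of f_t on the last column and p are all nonzero
    at t = 0, so they stay nonzero at some t where r is nonzero too.  The
    function r is what the curve has to offer away from its start: the value
    of another polynomial, or a minor witnessing independence. *)
Lemma generic_lift x v f g h (p : mpoly (n * n) F) (r : F -> F) a :
  incident_curve x v f -> v 0 = line_of g -> f 0 = form_of g ->
  entry_eval p g != 0 -> polyfun r -> r a != 0 ->
  exists t k, [/\ gl_mx k = lift_curve v f g h t, hess_point x k,
    entry_eval p k != 0 & r t != 0].
Proof.
move=> [pv pf fv fxv] v0 f0 pg pr ra.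
pose L := lift_curve v f g h.
have pL : polycurve L by exact: polycurve_lift_curve.
have L0 : L 0 = g by exact: lift_curve0.
have pc : polyfun (fun t => pairing (f t) (col ord_max (L t))).
  apply: polyfun_pairing => // i j.
  by apply: polyfun_ext (pL i ord_max) => t; rewrite [RHS]mxE.
have ps := polyfunM (polyfun_det pL) (polyfunM pc (polyfun_entry_eval p pL)).
have s0 : \det (L 0) * (pairing (f 0) (col ord_max (L 0))
    * entry_eval p (L 0)) != 0.
  rewrite L0 f0 pairing_form_of eqxx mul1r mulf_neq0 //.
  by have := gl_unit g; rewrite unitmxE unitfE.
have [t] := nonzero_polyfunM ps pr s0 ra.
rewrite !mulf_eq0 !negb_or => /andP[/andP[detL /andP[cL pLt]] rt].
have uL : L t \in unitmx by rewrite unitmxE unitfE.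
exists t, (MkGL uL); split=> //=.
have line_L : line_of (L t) = v t by rewrite /line_of col_lift_curve eqxx.
apply: (hess_point_of_form (f := f t)) => //; last by rewrite line_L.
move=> j jm; rewrite col_lift_curve (negbTE jm).
case: ifP => // _; rewrite pairingDr !pairingZr.
by rewrite !project_cols_kills !mulr0 addr0.
Qed.

Lemma incident_curve_shift (l : F) x y v f : x = y + l%:M ->
  incident_curve y v f -> incident_curve x v f.
Proof.
move=> -> [pv pf fv fyv]; split=> // t.
by rewrite mulmxDl mul_scalar_mx !pairingE fv fyv mulr0 addr0.
Qed.

Lemma independent_shift (l : F) x y (u : 'cV[F]_n) : x = y + l%:M ->
  independent u (y *m u) -> independent u (x *m u).
Proof.
move=> -> [i [j m0]]; exists i, j; apply: contraNneq m0.
rewrite mulmxDl mul_scalar_mx; move: (y *m u) => w.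
by rewrite /minor2 !mxE => <-; apply/eqP; ring.
Qed.

Lemma line_of_neq0 g : line_of g != 0.
Proof.
apply: contraTneq (gl_unit g) => g0; apply/negP => ug.
have /colP/(_ ord0) : invmx g *m line_of g = col ord0 1%:M.
  by rewrite /line_of colE mulmxA mulVmx // -colE.
by rewrite g0 mulmx0 !mxE eqxx => /esym/eqP; rewrite oner_eq0.
Qed.

Lemma pairing_form_line g : pairing (form_of g) (line_of g) = 0.
Proof. by rewrite pairing_form_of. Qed.

Definition rank_ge2_mod_scalars x : Prop :=
  forall l : F, not_rank_le1 (x - l%:M).

(** Density is phrased through nonvanishing of polynomials.  Both the incidence
    conditions and independence are insensitive to a scalar shift of x, so the
    eigenvalue of the line may be taken to be zero. *)
Lemma non_eigenline_dense x g (p : mpoly (n * n) F) :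
  rank_ge2_mod_scalars x -> hess_point x g -> entry_eval p g != 0 ->
  exists k, [/\ hess_point x k, entry_eval p k != 0
    & independent (line_of k) (x *m line_of k)].
Proof.
move=> rx xg pg; set v := line_of g.
have [iv|dep] := pselect (independent v (x *m v)); first by exists g.
have v0 := line_of_neq0 g.
have [l xv] := dependentP v0 dep.
have yv : (x - l%:M) *m v = 0 by rewrite mulmxBl xv mul_scalar_mx subrr.
have xE : x = (x - l%:M) + l%:M by rewrite subrK.
have [vt [ft [inc vt0 ft0 [a ia]]]] :=
  incident_curve_from_eigenpair (rx l) v0 yv (pairing_form_line g).
have {}inc := incident_curve_shift xE inc.
have [i [j m0]] := independent_shift xE ia.
have pm : polyfun (fun t => minor2 (vt t) (x *m vt t) i j).
  case: inc => pv _ _ _; apply: polyfun_minor2 => //.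
  by apply: polycurveM => //; exact: polycurve_cst.
have [t [k [kE xk pk mt]]] := generic_lift g inc vt0 ft0 pg pm m0.
exists k; split=> //; exists i, j.
by rewrite kE /line_of col_lift_curve.
Qed.

Lemma scalar_hess_point (l : F) g : hess_point l%:M g.
Proof.
by rewrite /hess_point mul_scalar_mx pairingZr pairing_form_line mulr0.
Qed.

Lemma hess_points_irreducible x g h (p q : mpoly (n * n) F) :
  rank_ge2_mod_scalars x -> hess_point x g -> hess_point x h ->
  entry_eval p g != 0 -> entry_eval q h != 0 ->
  exists k, [/\ hess_point x k, entry_eval p k != 0 & entry_eval q k != 0].
Proof.
move=> rx xg0 xh0 pg0 qh0.
have [{xg0 pg0}g [xg pg ig]] := non_eigenline_dense rx xg0 pg0.
have [{xh0 qh0}h [xh qh ih]] := non_eigenline_dense rx xh0 qh0.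
have [vt [ft [inc vt0 ft0 vt1 ft1]]] := connecting_curve ig ih
  (pairing_form_line g) xg (pairing_form_line h) xh.
have pL : polycurve (lift_curve vt ft g h).
  by case: inc => pv pf _ _; exact: polycurve_lift_curve.
have q1 : entry_eval q (lift_curve vt ft g h 1) != 0.
  by rewrite lift_curve1.
have [t [k [kE xk pk qk]]] :=
  generic_lift h inc vt0 ft0 pg (polyfun_entry_eval q pL) q1.
by exists k; split=> //; rewrite kE.
Qed.

Lemma GL_irreducible g h (p q : mpoly (n * n) F) :
  entry_eval p g != 0 -> entry_eval q h != 0 ->
  exists k, entry_eval p k != 0 /\ entry_eval q k != 0.
Proof.
move=> pg qh; pose L := segment g h.
have pL : polycurve L by apply: polycurve_segment; exact: polycurve_cst.
have s0 : \det (L 0) * entry_eval p (L 0) != 0.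
  rewrite /L segment0 mulf_neq0 //.
  by have := gl_unit g; rewrite unitmxE unitfE.
have q1 : entry_eval q (L 1) != 0 by rewrite /L segment1.
have [t] := nonzero_polyfunM (polyfunM (polyfun_det pL)
  (polyfun_entry_eval p pL)) (polyfun_entry_eval q pL) s0 q1.
rewrite !mulf_eq0 !negb_or => /andP[/andP[detL pLt] qLt].
have uL : L t \in unitmx by rewrite unitmxE unitfE.
by exists (MkGL uL).
Qed.

End Lifting.

(** * Closed subsets of the flag variety *)

Section FlagTopology.
Local Open Scope classical_set_scope.
Variables (F : fieldType) (n : nat).

Lemma closed_flagP (Z : set (flag_variety F n)) :
  closed Z <-> exists S, forall g, Z (coset g) <-> zero_locus S g.
Proof.
rewrite -openC; split.
  case=> S /seteqP[ZS SZ]; exists S => g; split=> Hg; apply: contrapT => nHg.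
    exact: (SZ g nHg Hg).
  exact: (ZS g nHg Hg).
case=> S ZS; exists S; apply/seteqP; split=> g /= nZ Sg; apply: nZ; exact/ZS.
Qed.

Lemma coset_eq (g h : GL F n) : coset g = coset h <-> same_coset g h.
Proof. exact: (rwP (eqmodP (coset_equiv F n) g h)). Qed.

(** Closed subsets of G/B correspond to B-stable zero loci in GL_n; this removes
    the quotient from the question. *)
Lemma reducible_locusP (Y : set (GL F n)) :
  reducible (@coset F n @` Y) <-> exists S1 S2 : set (mpoly (n * n) F),
    [/\ forall g h, same_coset g h -> zero_locus S1 g -> zero_locus S1 h,
        forall g h, same_coset g h -> zero_locus S2 g -> zero_locus S2 h,
        exists2 g, Y g & ~ zero_locus S1 g,
        exists2 g, Y g & ~ zero_locus S2 g
      & forall g, Y g -> zero_locus S1 g \/ zero_locus S2 g].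
Proof.
split.
  case=> Z1 [Z2 [/closed_flagP[S1 ZS1] /closed_flagP[S2 ZS2] p1 p2 cov]].
  have sat (S : set (mpoly (n * n) F)) (Z : set (flag_variety F n)) :
      (forall g, Z (coset g) <-> zero_locus S g) ->
      forall g h, same_coset g h -> zero_locus S g -> zero_locus S h.
    by move=> ZS g h /(coset_eq g h).2 gh /ZS; rewrite gh => /ZS.
  have out (S : set (mpoly (n * n) F)) (Z : set (flag_variety F n)) :
      (forall g, Z (coset g) <-> zero_locus S g) ->
      (@coset F n @` Y) `&` Z `<` @coset F n @` Y ->
      exists2 g, Y g & ~ zero_locus S g.
    move=> ZS [_ nsub]; apply: contrapT => none; apply: nsub => _ [g Yg <-].
    split; first by exists g.
    by apply/ZS; apply: contrapT => nS; apply: none; exists g.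
  exists S1, S2; split; [exact: sat ZS1|exact: sat ZS2|exact: out ZS1 p1|
    exact: out ZS2 p2|].
  move=> g Yg; have : (@coset F n @` Y) (coset g) by exists g.
  by rewrite cov => -[[_ /ZS1]|[_ /ZS2]]; [left|right].
case=> S1 [S2 [sat1 sat2 out1 out2 cov]].
pose Z (S : set (mpoly (n * n) F)) := [set coset g | g in zero_locus S].
have ZE (S : set (mpoly (n * n) F)) :
    (forall g h, same_coset g h -> zero_locus S g -> zero_locus S h) ->
    forall g, Z S (coset g) <-> zero_locus S g.
  move=> sat g; split=> [[h Sh /(coset_eq h g).1 hg]|Sg]; last by exists g.
  exact: sat hg Sh.
have prop (S : set (mpoly (n * n) F)) :
    (forall g h, same_coset g h -> zero_locus S g -> zero_locus S h) ->
    (exists2 g, Y g & ~ zero_locus S g) ->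
    (@coset F n @` Y) `&` Z S `<` @coset F n @` Y.
  move=> sat [g Yg nSg]; split; first by move=> z [].
  move=> sub; apply: nSg; apply/(ZE S sat).
  by case: (sub (coset g)) => //; exists g.
exists (Z S1), (Z S2); split.
- by apply/closed_flagP; exists S1; exact: ZE.
- by apply/closed_flagP; exists S2; exact: ZE.
- exact: prop.
- exact: prop.
apply/seteqP; split=> [_ [g Yg <-]|z [[]|[]]//].
by case: (cov g Yg) => Sg; [left|right]; split; exists g.
Qed.

End FlagTopology.

(** * Flags with a given line and hyperplane *)

Section FlagExistence.
Variables (F : numFieldType) (m : nat).
Notation n := m.+2.

Lemma unitmx_replace_row k (s : 'S_k) (a : 'I_k) (r : 'rV[F]_k) :
  r 0 (s a) != 0 ->
  \matrix_i (if i == a then r else delta_mx 0 (s i)) \in unitmx.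
Proof.
move=> rsa; set R := \matrix_i _.
rewrite -unitmx_tr -row_free_unit; apply: inj_row_free => z zR0.
have Rz i : pairing (if i == a then r else delta_mx 0 (s i)) z^T = 0.
  rewrite -[X in pairing X _](rowK (fun i => if i == a then r else _)) -/R.
  by rewrite /pairing -row_mul -[R]trmxK -trmx_mul zR0 trmx0 !mxE.
have zs j : j != s a -> z 0 j = 0.
  move=> jsa; have := Rz (s^-1%g j); rewrite permKV ifN.
    by rewrite pairing_delta_l mxE.
  by apply: contraNneq jsa => <-; rewrite permKV.
apply/rowP => j; rewrite [RHS]mxE; have [->|/zs//] := eqVneq j (s a).
have := Rz a; rewrite eqxx /pairing mxE (bigD1 (s a)) //= big1 => [|k' /zs zk].
  by rewrite addr0 mxE => /eqP; rewrite mulf_eq0 (negbTE rsa) => /eqP.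
by rewrite mxE zk mulr0.
Qed.

(** First A^T sends e_1 to v, then B fixes e_1 and has last row f A^T, which is
    possible because f A^T vanishes at e_1; the flag is A^T B^-1. *)
Lemma exists_flag (v : 'cV[F]_n) (f : 'rV[F]_n) :
  v != 0 -> f != 0 -> pairing f v = 0 ->
  exists g : GL F n, line_of g = v /\ form_of g = f.
Proof.
move=> /cV0Pn[i vi0] f0 fv.
pose A := \matrix_k (if k == ord0 then v^T else delta_mx 0 (tperm ord0 i k)).
have uA : A^T \in unitmx.
  by rewrite unitmx_tr unitmx_replace_row // tpermL mxE.
have lineA : A^T *m delta_mx ord0 0 = v.
  by rewrite -colE -tr_row rowK eqxx trmxK.
have : f *m A^T != 0.
  by apply: contraNneq f0 => fA0; rewrite -[f](mulmxK uA) fA0 mul0mx.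
case/rV0Pn => k fAk0.
have fA0 : (f *m A^T) 0 ord0 = 0 by rewrite -pairing_delta_r pairingA lineA.
have k0 : k != ord0 by apply: contraNneq fAk0 => ->; rewrite fA0.
pose B := \matrix_j (if j == ord_max then f *m A^T
                     else delta_mx 0 (tperm ord_max k j)).
have uB : B \in unitmx by rewrite unitmx_replace_row // tpermL.
have B0 : B *m delta_mx ord0 0 = delta_mx ord0 0 :> 'cV_n.
  apply/colP => j; have := row_mul j B (delta_mx ord0 0 : 'cV_n).
  move/rowP/(_ 0); rewrite [LHS]mxE => ->; rewrite rowK.
  rewrite -[LHS]/(pairing _ _) pairing_delta_r mxE eqxx andbT.
  have [->|jm] := eqVneq j ord_max; first by rewrite fA0.
  rewrite mxE eqxx /=; congr (_%:R).
  have s0 : tperm ord_max k ord0 = ord0 by rewrite tpermD.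
  by rewrite -[in LHS]s0 (inj_eq perm_inj) eq_sym.
have uAB : A^T *m invmx B \in unitmx by rewrite unitmx_mul uA unitmx_inv.
exists (MkGL uAB); rewrite /line_of /form_of /=; split.
  by rewrite colE -mulmxA -[in LHS]B0 mulKmx.
rewrite [invmx _](_ : _ = B *m invmx A^T).
  by rewrite row_mul rowK eqxx mulmxK.
by apply: (can_inj (mulKmx uAB)); rewrite mulmxV // mulmxA mulmxKV // mulmxV.
Qed.

(** Two linear conditions on a space of dimension at least three: the only use
    of n >= 3. *)
Lemma common_annihilator (u v : 'cV[F]_m.+3) :
  exists f : 'rV[F]_m.+3, [/\ f != 0, pairing f u = 0 & pairing f v = 0].
Proof.
set A := row_mx u v; have K0 : kermx A != 0.
  rewrite -mxrank_eq0 mxrank_ker -lt0n subn_gt0.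
  by rewrite (leq_ltn_trans (rank_leq_col _)).
exists (nz_row (kermx A)); rewrite nz_row_eq0; split=> //.
  have /sub_kermxP := nz_row_sub (kermx A).
  rewrite mul_mx_row -row_mx0 => /eq_row_mx[fu _].
  by rewrite /pairing fu mxE.
have /sub_kermxP := nz_row_sub (kermx A).
rewrite mul_mx_row -row_mx0 => /eq_row_mx[_ fv].
by rewrite /pairing fv mxE.
Qed.

End FlagExistence.

(** * Polynomial conditions on flags *)

Section FlagConditions.
Variables (F : numFieldType) (m : nat).
Notation n := m.+2.
Implicit Types (g h : GL F n).

Lemma same_coset_mul g h : same_coset g h ->
  exists b : 'M[F]_n, [/\ gl_mx h = g *m b, b \in unitmx & is_trig_mx b^T].
Proof.
case/andP => ub tb; exists (invmx g *m h); split=> //.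
by rewrite mulmxA mulmxV ?gl_unit // mul1mx.
Qed.

Lemma line_of_same_coset g h : same_coset g h ->
  exists c, line_of h = c *: line_of g.
Proof.
case/same_coset_mul => b [-> _ /is_trig_mxP tb]; exists (b ord0 ord0).
have colb : col ord0 b = b ord0 ord0 *: delta_mx ord0 0.
  apply/colP => i; rewrite !mxE eqxx andbT.
  have [->|i0] := eqVneq i ord0; first by rewrite mulr1.
  by rewrite mulr0 -(tb ord0 i) ?mxE // lt0n.
by rewrite /line_of [LHS]colE -mulmxA -colE colb -scalemxAr -colE.
Qed.

Lemma form_of_same_coset g h : same_coset g h ->
  exists c, form_of h = c *: form_of g.
Proof.
case/same_coset_mul => b [hE ub tb]; set b' := invmx b.
have /is_trig_mxP tb' : is_trig_mx b'^T.
  by rewrite trmx_inv trigmxV ?unitmx_tr.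
exists (b' ord_max ord_max).
have rowb : row ord_max b' = b' ord_max ord_max *: delta_mx 0 ord_max.
  apply/rowP => j; rewrite !mxE eqxx /=.
  have [->|jm] := eqVneq j ord_max; first by rewrite mulr1.
  rewrite mulr0 -(tb' j ord_max) ?mxE // ltn_neqAle -ltnS ltn_ord andbT.
  exact: jm.
have invh : invmx h = b' *m invmx g.
  apply: (can_inj (mulKmx (gl_unit h))); rewrite mulmxV ?gl_unit // hE.
  by rewrite -mulmxA [b *m _]mulmxA mulmxV // mul1mx mulmxV ?gl_unit.
by rewrite /form_of invh row_mul rowb -scalemxAl -rowE.
Qed.

(** The matrix of coordinate functions: evaluating expressions in it yields the
    polynomials that define conditions on g. *)
Definition generic_mx : 'M[mpoly (n * n) F]_n :=
  \matrix_(i, j) mpolyX F (mnm1 (mxvec_index i j)).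

Local Notation eval_at A := (meval (fun k => mxvec A 0 k)).

Lemma eval_generic_mx A : map_mx (eval_at A) generic_mx = A.
Proof. by apply/matrixP => i j; rewrite !mxE mevalXU mxvecE. Qed.

Lemma eval_const_mx A k l (B : 'M[F]_(k, l)) :
  map_mx (eval_at A) (map_mx (@mpolyC (n * n) F) B) = B.
Proof. by apply/matrixP => i j; rewrite !mxE mevalC. Qed.

Lemma line_condition (r : 'rV[F]_n) : exists p : mpoly (n * n) F,
  forall g, entry_eval p g = 0 <-> pairing r (line_of g) = 0.
Proof.
exists ((map_mx (@mpolyC (n * n) F) r *m col ord0 generic_mx) 0 0) => g.
rewrite -[entry_eval _ _]/(eval_at g _).
have -> (B : 'M[mpoly (n * n) F]_1) :
  eval_at g (B 0 0) = map_mx (eval_at g) B 0 0 by rewrite mxE.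
by rewrite map_mxM eval_const_mx map_col eval_generic_mx.
Qed.

(** The last row of the adjugate is polynomial in g and proportional to the
    last row of the inverse. *)
Lemma form_condition (u : 'cV[F]_n) : exists p : mpoly (n * n) F,
  forall g, entry_eval p g = 0 <-> pairing (form_of g) u = 0.
Proof.
exists ((row ord_max (\adj generic_mx) *m map_mx (@mpolyC (n * n) F) u) 0 0).
move=> g; rewrite -[entry_eval _ _]/(eval_at g _).
have -> (B : 'M[mpoly (n * n) F]_1) :
  eval_at g (B 0 0) = map_mx (eval_at g) B 0 0 by rewrite mxE.
rewrite map_mxM eval_const_mx map_row map_mx_adj eval_generic_mx.
rewrite -[X in X = 0 <-> _]/(pairing _ _).
have detg : \det g != 0 by rewrite -unitfE -unitmxE gl_unit.
have -> : row ord_max (\adj g) = \det g *: form_of g.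
  rewrite /form_of /invmx gl_unit; apply/rowP => j.
  by rewrite !mxE mulrA mulfV // mul1r.
rewrite pairingZl; split=> [/eqP|->]; last by rewrite mulr0.
by rewrite mulf_eq0 (negbTE detg) => /eqP.
Qed.

Lemma hessenberg_max_point (x : 'M[F]_n) g :
  hessenberg_space (m_max n) (invmx g *m x *m g) <-> hess_point x g.
Proof.
have -> : hess_point x g = ((invmx g *m x *m g) ord_max ord0 = 0).
  rewrite /hess_point /line_of /form_of -pairingA -row_mul pairing_col.
  by rewrite -row_mul mxE.
split=> [H|e i j]; first exact: H.
rewrite /m_max; case: eqP => [j0|_].
  move=> im; have -> : i = ord_max.
    by apply/val_inj/eqP; rewrite /= eqn_leq -ltnS ltn_ord.
  by have -> : j = ord0 by exact: val_inj.
by rewrite ltnNge ltn_ord.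
Qed.

End FlagConditions.

(** * The criterion *)

Section Reducibility.
Variables (F : numFieldType) (m : nat).
Notation n := m.+3.

Lemma rank1_factor k (A : 'M[F]_k) : \rank A = 1%N ->
  exists (u : 'cV[F]_k) (f : 'rV[F]_k), [/\ u != 0, f != 0 & A = u *m f].
Proof.
move=> r1; have A0 : A != 0 by rewrite -mxrank_eq0 r1.
move: (col_base A) (row_base A) (mulmx_base A); rewrite r1 => u f uf.
exists u, f; split=> //; apply: contraNneq A0 => e0.
  by rewrite -uf e0 mul0mx.
by rewrite -uf e0 mulmx0.
Qed.

Lemma hessenberg_reducibleP (x : 'M[F]_n) :
  reducible (hessenberg_variety x (hessenberg_space (m_max n)))
  <-> exists l : F, \rank (x - l%:M) = 1%N.
Proof.
rewrite reducible_locusP; split; last first.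
  case=> l /rank1_factor[u [r [u0 r0 xE]]].
  have hessE (g : GL F n) : hess_point x g <->
      pairing (form_of g) u * pairing r (line_of g) = 0.
    rewrite /hess_point -[x](subrK l%:M) xE mulmxDl mul_scalar_mx pairingDr.
    rewrite pairingZr pairing_form_line mulr0 addr0 -mulmxA.
    by rewrite (mulmx_pairing r) mul_mx_scalar pairingZr mulrC.
  have [p1 p1E] := form_condition u.
  have [p2 p2E] := line_condition r.
  have locE p (g : GL F n) :
      zero_locus [set p]%classic g <-> entry_eval p g = 0.
    by split=> [|pg _ ->//]; apply.
  exists [set p1]%classic, [set p2]%classic; split.
  - move=> g h /form_of_same_coset[c hE]; rewrite !locE !p1E hE pairingZl => ->.
    by rewrite mulr0.
  - move=> g h /line_of_same_coset[c hE]; rewrite !locE !p2E hE pairingZr => ->.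
    by rewrite mulr0.
  (* A flag with r v = 0 and f u = 1, off the first component. *)
  - have [f fu] := vec_dual u0.
    have [w [w0 wr wf]] := common_annihilator r^T f^T.
    have tr (s : 'rV[F]_n) : pairing s w^T = pairing w s^T.
      by rewrite /pairing -[s in LHS]trmxK -trmx_mul mxE.
    have f0 : f != 0.
      by apply: contra_eq_neq fu => ->; rewrite pairing0l eq_sym oner_neq0.
    have wT0 : w^T != 0 by rewrite trmx_eq0.
    have fwT : pairing f w^T = 0 by rewrite tr.
    have [g [gl gf]] := exists_flag wT0 f0 fwT.
    exists g; last by rewrite locE p1E gf fu; apply/eqP; exact: oner_neq0.
    by apply/hessenberg_max_point/hessE; rewrite gl tr wr mulr0.
  (* A flag with f u = 0 and r v = 1, off the second one. *)
  - have [v rv] := form_dual r0.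
    have [f [f0 fu fv]] := common_annihilator u v.
    have v0 : v != 0.
      by apply: contra_eq_neq rv => ->; rewrite pairing0r eq_sym oner_neq0.
    have [g [gl gf]] := exists_flag v0 f0 fv.
    exists g; last by rewrite locE p2E gl rv; apply/eqP; exact: oner_neq0.
    by apply/hessenberg_max_point/hessE; rewrite gf fu mul0r.
  - move=> g /hessenberg_max_point/hessE/eqP; rewrite mulf_eq0.
    by case/orP => /eqP e; [left|right]; rewrite locE ?p1E ?p2E.
case=> S1 [S2 [_ _ [g Yg nS1] [h Yh nS2] cov]].
have [//|no_rank1] := pselect (exists l : F, \rank (x - l%:M) = 1%N).
have witness S (k : GL F n) : ~ zero_locus S k ->
    exists2 p, S p & entry_eval p k != 0.
  move=> nS; apply: contrapT => none; apply: nS => p Sp.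
  by apply/eqP/negPn/negP => pk; apply: none; exists p.
have [p Sp pg] := witness _ _ nS1; have [q Sq qh] := witness _ _ nS2.
suff [k [Yk pk qk]] : exists k : GL F n,
    [/\ hess_point x k, entry_eval p k != 0 & entry_eval q k != 0].
  have [Sk|Sk] := cov k ((hessenberg_max_point x k).2 Yk).
    by rewrite (Sk p Sp) eqxx in pk.
  by rewrite (Sk q Sq) eqxx in qk.
have [[l xl]|nonscalar] := pselect (exists l : F, x = l%:M).
  have [k [pk qk]] := GL_irreducible pg qh.
  by exists k; split=> //; rewrite xl; exact: scalar_hess_point.
apply: hess_points_irreducible pg qh; [|exact/hessenberg_max_point..].
move=> l u f xE; have := mulmx_max_rank u f; rewrite -xE.
case r: (\rank (x - l%:M)) => [|[|//]] _.
  by apply: nonscalar; exists l; apply/eqP; rewrite -subr_eq0 -mxrank_eq0 r.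
by apply: no_rank1; exists l.
Qed.

End Reducibility.

Theorem theorem4 (R : realType) (n : nat) (hn : (2 < n)%N) (x : 'M[R[i]]_n) :
  reducible (hessenberg_variety x (hessenberg_space (m_max n)))
  <-> exists lambda : R[i], \rank (x - lambda%:M) = 1%N.
Proof.
by case: n hn x => [|[|[|m]]] // _ x; exact: hessenberg_reducibleP.
Qed.
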